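(* A tree $T$ has exactly three distinct distance eigenvalues if and only if $T$ is a star, i.e. $T\cong K_{1,m}$ for some integer $m\ge 2$.
   Context: For a connected graph $G$ with vertices $v_1,\ldots,v_n$, the distance matrix $D(G)$ is the $n\times n$ real symmetric matrix whose $(i,j)$-entry is the length of a shortest path from $v_i$ to $v_j$. The distance eigenvalues of $G$ are the eigenvalues of $D(G)$. $K_{1,m}$ is the complete bipartite graph with parts of sizes $1$ and $m$. *)

(* Defs.v *)
From HB Require Import structures.
From mathcomp Require Import all_boot all_order all_algebra.
From mathcomp Require Import reals.

Set Implicit Arguments.
Unset Strict Implicit.
Unset Printing Implicit Defensive.

Import Order.TTheory GRing.Theory Num.Theory.

Local Open Scope ring_scope.

Definition simple_graph (V : finType) (e : rel V) : Prop :=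
  symmetric e /\ irreflexive e.

Definition connected_graph (V : finType) (e : rel V) : Prop :=
  (0 < #|V|)%N /\ forall x y : V, connect e x y.

(* In a simple graph, an edge xy traversed back and forth is the [ucycle]
   [:: x; y]; genuine cycles are those with at least 3 vertices. *)
Definition acyclic_graph (V : finType) (e : rel V) : Prop :=
  forall c : seq V, ucycle e c -> (size c <= 2)%N.

Definition is_tree (V : finType) (e : rel V) : Prop :=
  [/\ simple_graph e, connected_graph e & acyclic_graph e].

Definition graph_iso (V W : finType) (e : rel V) (e' : rel W) : Prop :=
  exists f : V -> W, bijective f /\ forall x y : V, e' (f x) (f y) = e x y.

Definition complete_bipartite (p q : nat) : rel ('I_p + 'I_q)%type :=
  fun u v => match u, v with
             | inl _, inr _ | inr _, inl _ => true
             | _, _ => false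
             end.

Definition has_path_of_length (V : finType) (e : rel V) (x y : V) (k : nat) :
  bool :=
  [exists p : k.-tuple V, [&& path e x p, last x p == y & uniq (x :: p)]].

(* The least k such that there is a path of length k from x to y. A path has
   fewer than #|V| edges, so searching k < #|V| loses nothing; the junk value
   #|V| is returned when x and y are not connected. *)
Definition graph_dist (V : finType) (e : rel V) (x y : V) : nat :=
  find (has_path_of_length e x y) (iota 0 #|V|).

Definition distance_matrix (R : realType) (V : finType) (e : rel V) :
  'M[R]_#|V| :=
  \matrix_(i, j) (graph_dist e (enum_val i) (enum_val j))%:R.

Definition distance_eigenvalue (R : realType) (V : finType) (e : rel V)
  (a : R) : bool := eigenvalue (distance_matrix R e) a.

Definition num_distinct_distance_eigenvalues (R : realType) (V : finType)
  (e : rel V) (k : nat) : Prop :=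
  exists s : seq R,
    [/\ uniq s, size s = k & forall a : R, (a \in s) = distance_eigenvalue e a].

(* Main.v *)
Require Import Defs.
From HB Require Import structures.
From mathcomp Require Import all_boot all_order all_algebra.
From mathcomp Require Import reals complex ring lra zify.

(** Let D be the distance matrix of a tree, and write d for the distance.

    Suppose that D has exactly three eigenvalues a < b < c. Being real
    symmetric, D is annihilated by (X - a)(X - b)(X - c); being positive off
    the diagonal, it has by Perron's theorem a positive vector x that spans
    its c-eigenspace. The rows of (D - a)(D - b) are c-eigenvectors, so
    (D - a)(D - b) = k x x^T for some scalar k, that is
      D^2 + sg D + p = k x x^T   with sg = - (a + b) and p = a b
    ([three_eigenvalues_rank_one]).

    This identity is rigid on a tree. If u is a pendant vertex with neighbour
    v, the rows of u and v in D differ by the constant 1 except at u, so the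
    difference of the rows of u and v in the identity involves D only linearly
    ([pendant_row]). Take for u and w the ends of a diameter, with neighbours
    v and z, and suppose d u w >= 3. Comparing the equations of the pairs (u, v)
    and (w, z) at u and w, where their difference takes opposite values, the
    positivity of x shows that both equations are the same. Their coordinates
    then determine sg and p in terms of d u w, and show that every vertex other
    than u, v, w, z is equidistant from u and w. Hence either d u w = 3 and the
    tree is the path u v z w, or d u w = 4 and v, z have a common neighbour m
    and degree 2. In the first case the equations at u and v contradict each
    other; in the second, the same kind of equation for the edge v m does
    ([no_far_pendants]). So the diameter is at most 2, and the tree is a star.

    Conversely the eigenvectors of a star are explicit: an eigenvector either
    belongs to the eigenvalue -2, or is constant on the leaves, which leaves
    the two roots of a quadratic equation ([star_eigenvalue]). *)

Set Implicit Arguments.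
Unset Strict Implicit.
Unset Printing Implicit Defensive.

Import Order.TTheory GRing.Theory Num.Theory.

(** * Distances in a tree *)

Section TreeDistance.

Variables (V : finType) (e : rel V).
Hypothesis tree_e : is_tree e.

Local Notation d := (graph_dist e).

Let e_sym : symmetric e. Proof. by case: tree_e => [[]]. Qed.
Let e_irr : irreflexive e. Proof. by case: tree_e => [[]]. Qed.

(** Where two paths with common ends first branch off, at x towards a and b, the
    rest of one path followed by the reverse of the rest of the other is a walk
    from a to b avoiding x. Shortened to a path, it closes up through x into a
    cycle with at least three vertices. *)
Lemma tree_path_unique x p q :
    path e x p -> path e x q -> uniq (x :: p) -> uniq (x :: q) ->
  last x p = last x q -> p = q.
Proof.
elim: p x q => [|a p IHp] x [|b q] //=.
- by move=> _ _ _ /andP[/negP xNq _] xE; case: xNq; rewrite xE mem_last.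
- by move=> _ _ /andP[/negP xNp _] _ xE; case: xNp; rewrite -xE mem_last.
move=> /andP[exa pp] /andP[exb pq] /andP[xNp up] /andP[xNq uq] eq_last.
have [eq_ab|neq_ab] := eqVneq a b.
  by rewrite -{b}eq_ab in exb pq xNq uq eq_last *; rewrite (IHp a q).
pose w := p ++ rev (belast b q).
have pw : path e a w.
  rewrite cat_path pp eq_last rev_path /=.
  by rewrite (eq_path (e' := e)) // => u v; rewrite e_sym.
have lw : last a w = b.
  rewrite last_cat eq_last; case: (q) => [|c q'] //=.
  by rewrite rev_cons last_rcons.
have xNw : x \notin a :: w.
  rewrite inE mem_cat mem_rev !negb_or.
  move: xNp; rewrite inE negb_or => /andP[-> ->] /=.
  by apply: contra xNq => /mem_belast.
case/shortenP: pw lw => r pr ur sub_r lr.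
have xNr : x \notin a :: r.
  move: xNw; rewrite !inE !negb_or => /andP[-> /=].
  by apply: contra => /sub_r.
case: tree_e => _ _ /(_ (x :: a :: r)) acyc.
have /acyc : ucycle e (x :: a :: r).
  by rewrite /ucycle cons_uniq xNr ur /= rcons_path exa pr lr e_sym exb.
by case: (r) lr => [|//] /= ab; rewrite ab eqxx in neq_ab.
Qed.

(** There is only one path between two vertices of a tree, so the search that
    defines [graph_dist] can only succeed at its length. *)
Lemma graph_dist_path x p :
  path e x p -> uniq (x :: p) -> d x (last x p) = size p.
Proof.
move=> pp up; have lt_p : size p < #|V|.
  by have /card_uniqP/= <- := up; exact: max_card.
rewrite /graph_dist (eq_find (a2 := pred1 (size p))).
  by rewrite -/(index _ _) -[X in index X _]add0n -(nth_iota 0 0 lt_p)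
     index_uniq ?size_iota ?iota_uniq.
move=> k /=; apply/existsP/eqP => [[t /and3P[pt /eqP lt ut]]|->].
  by rewrite -(tree_path_unique pt pp ut up lt) size_tuple.
by exists (in_tuple p); rewrite pp eqxx up.
Qed.

Lemma tree_path_exists x y :
  exists p, [/\ path e x p, uniq (x :: p) & last x p = y].
Proof.
case: tree_e => _ [_ conn] _; have /connectP[p pp ->] := conn x y.
by case/shortenP: pp => q pq uq _; exists q.
Qed.

Lemma tree_dist_eq0 x y : (d x y == 0) = (x == y).
Proof.
have [p [pp up <-]] := tree_path_exists x y; rewrite graph_dist_path //.
case: p pp up => [|a p] /=; first by rewrite !eqxx.
move=> _ /andP[xNp _]; apply/esym/negbTE.
by apply: contra xNp => /eqP->; exact: mem_last.
Qed.

Lemma tree_distC x y : d x y = d y x.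
Proof.
have [p [pp up <-]] := tree_path_exists x y; rewrite graph_dist_path //.
have pr : path e (last x p) (rev (belast x p)).
  by rewrite rev_path (eq_path (e' := e)) // => u v; rewrite e_sym.
have lr : last (last x p) (rev (belast x p)) = x.
  by case: (p) => [|c q'] //=; rewrite rev_cons last_rcons.
rewrite -{2}lr graph_dist_path ?size_rev ?size_belast //.
by rewrite -rev_rcons -lastI rev_uniq.
Qed.

Lemma tree_dist_edge x y : e x y = (d x y == 1).
Proof.
have [p [pp up <-]] := tree_path_exists x y; rewrite graph_dist_path //.
case: p pp up => [|a [|b p]] /=; rewrite ?e_irr ?andbT // => /andP[exa pp] up.
apply/negbTE/negP => exy; case/andP: (up) => xN _.
have xNl : x != last b p.
  by apply: contra xN => /eqP->; rewrite in_cons mem_last orbT.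
suff : [:: a, b & p] = [:: last b p] by [].
by apply: (@tree_path_unique x) => //=; rewrite ?exa ?exy // inE xNl.
Qed.

Lemma tree_closer_nbr x k : x != k -> exists2 y, e x y & d x k = (d y k).+1.
Proof.
have [[|a p] [/= pp up <-]] := tree_path_exists x k; first by rewrite !eqxx.
case/andP: pp => exa pa _; exists a => //.
by case/andP: (up) => _ ua; rewrite -[last a p]/(last x (a :: p)) 
   !graph_dist_path //= exa.
Qed.

(** The path from x to k goes through y; it avoids every other neighbour z of
    x, since otherwise x z would start a second path from x to k. Hence z
    followed by this path is the path from z to k. *)
Lemma tree_closer_nbr_unique x k y z :
  e x y -> e x z -> d x k = (d y k).+1 -> y != z -> d z k = (d x k).+1.
Proof.
move=> exy exz dxy yNz.
have [p [pp up lp]] := tree_path_exists y k.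
have [q [pq uq lq]] := tree_path_exists z k.
have dy : d y k = size p by rewrite -lp graph_dist_path.
have xNp : x \notin y :: p.
  apply/negP => xp; case/splitPl: xp dxy dy pp up lp => p1 p2 l1.
  rewrite cat_path last_cat l1 => dxk dyk /andP[pp1 pp2].
  rewrite -cat_cons cat_uniq lastI l1 => /and3P[_ N2 u2] lp.
  have : d x k = size p2.
    rewrite -lp graph_dist_path //= u2 andbT.
    apply: contra N2 => xp2; apply/hasP; exists x => //.
    by rewrite mem_rcons mem_head.
  rewrite dxk dyk size_cat => /eqP.
  by rewrite eqn_leq -addSn leqNgt ltnS leq_addl.
have uxp : uniq (x :: y :: p) by rewrite cons_uniq xNp.
have pxp : path e x (y :: p) by rewrite /= exy.
have zNp : z \notin x :: y :: p.
  rewrite 2!inE !negb_or; apply/and3P; split.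
  - by apply: contraTneq exz => ->; rewrite e_irr.
  - by rewrite eq_sym.
  apply/negP => zp; case/splitPr: zp (pxp) (uxp) (lp) => p1 p2 pxp' uxp' lp'.
  suff [yz] : y :: p1 ++ z :: p2 = z :: p2 by rewrite yz eqxx in yNz.
  apply: (tree_path_unique pxp' _ uxp').
  - move: pxp'; rewrite -cat_cons cat_path => /andP[_ /= /andP[_ ->]].
    by rewrite exz.
  - move: uxp'; rewrite -cat_cons cons_uniq cat_uniq mem_cat negb_or.
    by move=> /andP[/andP[_ xNz] /and3P[_ _ uz]]; rewrite cons_uniq xNz.
  - by rewrite /= last_cat.
rewrite dxy dy -lp -[last y p]/(last z [:: x, y & p]) graph_dist_path //=.
  by rewrite e_sym exz exy.
by rewrite zNp.
Qed.

(** Adjacent vertices are never equidistant from a third one: a tree is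
    bipartite. *)
Lemma tree_edge_dist x y k :
  e x y -> (d x k == (d y k).+1) || (d y k == (d x k).+1).
Proof.
move=> exy; have [<-|xNk] := eqVneq x k.
  have /eqP-> : d x x == 0 by rewrite tree_dist_eq0.
  by rewrite tree_distC -tree_dist_edge exy orbT.
have [z exz dxk] := tree_closer_nbr xNk.
have [<-|zNy] := eqVneq z y; first by rewrite dxk eqxx.
by rewrite (tree_closer_nbr_unique exz exy dxk zNy) eqxx orbT.
Qed.

(** An end u of a longest path has no neighbour but v, as any other neighbour
    would be farther from w; hence every path that leaves u starts with v. *)
Lemma far_vertex_pendant u v w k :
    (forall x, d x w <= d u w) -> e u v -> d u w = (d v w).+1 ->
  k != u -> d u k = (d v k).+1.
Proof.
move=> far euv duw kNu; rewrite eq_sym in kNu.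
have [y euy duk] := tree_closer_nbr kNu.
have [->//|vNy] := eqVneq v y.
by have := far y; rewrite (tree_closer_nbr_unique euv euy duw vNy) ltnn.
Qed.

Lemma diameter2_center u w :
    u != w -> (forall x y, d x y <= d u w) -> d u w <= 2 ->
  exists c, forall x, x != c -> e c x.
Proof.
move=> uNw diam le2; have [c euc duc] := tree_closer_nbr uNw.
exists c => x xNc; have [->|xNu] := eqVneq x u; first by rewrite e_sym.
have := leq_trans (diam u x) le2.
rewrite (far_vertex_pendant _ euc duc xNu) // ltnS tree_dist_edge.
by case: (d c x) (tree_dist_eq0 c x) => [|[|]]//; rewrite eq_sym (negbTE xNc).
Qed.

Lemma center_edge c x y :
  (forall x, x != c -> e c x) -> e x y = ((x == c) != (y == c)).
Proof.
move=> star; have [->|xNc] := eqVneq x c; have [->|yNc] := eqVneq y c.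
- exact: e_irr.
- exact: star.
- by rewrite e_sym star.
apply/negbTE/negP => /(@tree_edge_dist _ _ c).
have dc k : k != c -> d k c = 1.
  by move=> /star; rewrite e_sym tree_dist_edge => /eqP.
by rewrite !dc.
Qed.

Lemma tree_diametral_pair :
  exists u w, forall x y, d x y <= d u w.
Proof.
case: tree_e => _ [V_gt0 _] _; have /card_gt0P[x0 _] := V_gt0.
have [[u w] _ max_uw] := @arg_maxnP _ (x0, x0) xpredT (fun xy => d xy.1 xy.2) isT.
by exists u, w => x y; exact: (max_uw (x, y)).
Qed.

End TreeDistance.

Local Open Scope ring_scope.

(** * Spectral theory of real symmetric matrices *)

(** Conjugation by P turns the product into a diagonal matrix, whose i-th entry
    has the vanishing factor d_i - d_i. *)
Lemma diag_conj_annihilator (K : fieldType) n (P Q : 'M[K]_n) (d : 'rV[K]_n)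
    (s : seq K) :
    P *m Q = 1%:M -> Q *m P = 1%:M -> (forall i, d 0 i \in s) ->
  \prod_(a <- s) (Q *m diag_mx d *m P - a%:M) = 0.
Proof.
move=> PQ QP d_s.
have -> : \prod_(a <- s) (Q *m diag_mx d *m P - a%:M)
    = Q *m diag_mx (\row_i \prod_(a <- s) (d 0 i - a)) *m P.
  elim: {d_s} s => [|a s IHs].
    rewrite big_nil; have -> : \row_i \prod_(a <- [::]) (d 0 i - a) = const_mx 1.
      by apply/rowP => i; rewrite !mxE big_nil.
    by rewrite diag_const_mx mulmx1 QP.
  rewrite big_cons {}IHs -mulmxE.
  have -> : a%:M = Q *m diag_mx (const_mx a) *m P.
    by rewrite diag_const_mx mul_mx_scalar -scalemxAl QP scalemx1.
  rewrite -mulmxBl -mulmxBr -linearB /= -!mulmxA (mulmxA P) PQ mul1mx.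
  rewrite (mulmxA (diag_mx _)) mulmx_diag; congr (_ *m (diag_mx _ *m _)).
  by apply/rowP => i; rewrite !mxE big_cons.
have -> : \row_i \prod_(a <- s) (d 0 i - a) = 0.
  apply/rowP => i; rewrite !mxE; apply/eqP; rewrite prodf_seq_eq0.
  by apply/hasP; exists (d 0 i); rewrite ?subrr ?eqxx.
by rewrite linear0 mulmx0 mul0mx.
Qed.

Section RealSymmetric.

Local Open Scope sesquilinear_scope.
Local Open Scope complex_scope.

Variables (R : rcfType) (n : nat) (A : 'M[R]_n).
Hypothesis symA : A^T = A.

Local Notation C := (complex R).
Local Notation toC := (real_complex R).

(** The spectral theorem for normal complex matrices, applied to the
    complexification of A: it diagonalises A in a unitary basis, and the
    eigenvalues are real because A is Hermitian. *)
Lemma symmetric_spectral : exists (P : 'M[C]_n) (d : 'rV[R]_n),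
  [/\ P \is unitarymx, map_mx toC A = P^t* *m diag_mx (map_mx toC d) *m P
    & forall i, eigenvalue A (d 0 i)].
Proof.
have realC (x : R) : toC x \is Num.real by rewrite complex_real.
have realA : map_mx toC A \is a realmx by apply/mxOverP => i j; rewrite mxE.
have hermA : map_mx toC A \is hermsymmx.
  apply: realsym_hermsym realA; apply/is_hermitianmxP.
  by rewrite expr0 scale1r map_mx_id // map_trmx symA.
have := hermitian_spectral_diag_real hermA.
have /orthomx_spectralP := hermitian_normalmx hermA.
set P := spectralmx _; set d := spectral_diag _ => AE d_real.
have unitP : P \is unitarymx by exact: spectral_unitarymx.
have dE : d = map_mx toC (map_mx (@complex.Re R) d).
  by apply/rowP => i; rewrite !mxE RRe_real //; exact: (mxOverP d_real).
exists P, (map_mx (@complex.Re R) d); rewrite -dE -invmx_unitary //; split=> // i.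
suff : eigenvalue (map_mx toC A) (d 0 i).
  have -> : d 0 i = toC (map_mx (@complex.Re R) d 0 i).
    by rewrite [in LHS]dE [LHS]mxE.
  by rewrite eigenvalue_map.
apply/eigenvalueP; exists (row i P).
  rewrite AE -row_mul !mulmxA mulmxV ?mul1mx ?unitarymx_unit //.
  by rewrite row_mul row_diag_mx -scalemxAl -rowE.
have := unitarymx_unit unitP; apply: contraTneq => Pi0.
rewrite -row_free_unit; apply/negP => /row_freeP[B PB].
have := congr1 (row i) PB; rewrite row_mul Pi0 mul0mx => /rowP/(_ i).
by rewrite !mxE eqxx => /eqP; rewrite eq_sym oner_eq0.
Qed.

Lemma symmetric_annihilator (s : seq R) :
  (forall a, eigenvalue A a -> a \in s) -> \prod_(a <- s) (A - a%:M) = 0.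
Proof.
move=> eig_s; have [P [d [unitP AE eig_d]]] := symmetric_spectral.
have PtP : P^t* *m P = 1%:M by rewrite -invmx_unitary // mulVmx ?unitarymx_unit.
have PPt : P *m P^t* = 1%:M by exact/unitarymxP.
have prodE (t : seq R) : map_mx toC (\prod_(a <- t) (A - a%:M)) =
    \prod_(a <- map toC t) (map_mx toC A - a%:M).
  elim: t => [|a t IHt]; first by rewrite !big_nil map_mx1.
  by rewrite !big_cons map_mxM IHt map_mxB map_scalar_mx.
apply: (map_mx_inj (f := toC)); rewrite prodE map_mx0 AE.
by apply: diag_conj_annihilator => // i; rewrite mxE map_f ?eig_s.
Qed.

(** In a unitary eigenbasis with eigenvalues d_i and coordinates w_i of v, the
    number v (c - A) v^T is the sum of the (c - d_i) |w_i|^2, a sum of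
    nonnegative terms. If it is at most 0, then all terms vanish, which means
    that v only has coordinates in the c-eigenspace. *)
Lemma rayleigh_max (c : R) (v : 'rV[R]_n) :
    (forall a, eigenvalue A a -> a <= c) ->
  c * (v *m v^T) 0 0 <= (v *m A *m v^T) 0 0 -> v *m A = c *: v.
Proof.
move=> eig_le vAv; have [P [d [unitP AE eig_d]]] := symmetric_spectral.
have PtP : P^t* *m P = 1%:M by rewrite -invmx_unitary // mulVmx ?unitarymx_unit.
pose N := c%:M - A; pose g : 'rV[R]_n := const_mx c - d.
have NE : map_mx toC N = P^t* *m diag_mx (map_mx toC g) *m P.
  rewrite map_mxB map_scalar_mx AE map_mxB map_const_mx raddfB /= mulmxBr mulmxBl.
  by rewrite diag_const_mx mul_mx_scalar -scalemxAl PtP scalemx1.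
have g_ge0 i : 0 <= g 0 i by rewrite !mxE subr_ge0 eig_le.
suff vN0 : v *m N = 0.
  by apply/eqP; rewrite -subr_eq0 -mul_mx_scalar -opprB -mulmxBr vN0 oppr0.
apply: (map_mx_inj (f := toC)); rewrite map_mx0 map_mxM NE !mulmxA.
set w := map_mx toC v *m P^t*.
suff -> : w *m diag_mx (map_mx toC g) = 0 by exact: mul0mx.
have wE : \sum_i toC (g 0 i) * (w 0 i * (w 0 i)^*) <= 0.
  have -> : \sum_i toC (g 0 i) * (w 0 i * (w 0 i)^*) =
      toC ((v *m N *m v^T) 0 0).
    transitivity ((w *m diag_mx (map_mx toC g) *m w^t*) 0 0).
      rewrite mul_mx_diag !mxE; apply: eq_bigr => i _; rewrite !mxE.
      by rewrite mulrCA mulrA.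
    transitivity ((map_mx toC (v *m N *m v^T)) 0 0); last by rewrite mxE.
    rewrite !map_mxM NE !mulmxA trmx_mul map_mxM trmxCK mulmxA.
    congr ((_ *m _) 0 0); apply/matrixP => i j; rewrite !mxE.
    by apply/CrealP; rewrite complex_real.
  rewrite lecR mulmxBr mulmxBl mul_mx_scalar -scalemxAl !mxE subr_le0.
  by move: vAv; rewrite !mxE.
have term_ge0 i : 0 <= toC (g 0 i) * (w 0 i * (w 0 i)^*).
  by rewrite mulr_ge0 ?mul_conjC_ge0 // lecR.
apply/rowP => i; rewrite mul_mx_diag [RHS]mxE [LHS]mxE [X in _ * X]mxE.
have /eqP : toC (g 0 i) * (w 0 i * (w 0 i)^*) = 0.
  have : \sum_i toC (g 0 i) * (w 0 i * (w 0 i)^*) == 0.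
    by rewrite eq_le wE sumr_ge0.
  by rewrite psumr_eq0 // => /allP/(_ i (mem_index_enum _))/eqP.
rewrite mulf_eq0 mul_conjC_eq0 => /orP[/eqP->|/eqP->].
  by rewrite mulr0.
by rewrite mul0r.
Qed.

End RealSymmetric.

(** * Perron vectors and the rank-one identity *)

Section PositiveSymmetric.

Variables (R : rcfType) (n : nat) (A : 'M[R]_n).
Hypothesis symA : A^T = A.
Hypothesis diagA : forall i, 0 <= A i i.
Hypothesis posA : forall i j, i != j -> 0 < A i j.

Let A_ge0 i j : 0 <= A i j.
Proof. by have [->|/posA/ltW] := eqVneq i j. Qed.

Variable c : R.
Hypothesis c_max : forall a, eigenvalue A a -> a <= c.

(** Taking absolute values keeps v v^T and does not decrease v A v^T, so the
    absolute value of v still maximises the Rayleigh quotient. *)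
Lemma top_eigenvector_abs (v : 'rV[R]_n) :
  v *m A = c *: v -> map_mx Num.norm v *m A = c *: map_mx Num.norm v.
Proof.
move=> vA; apply: rayleigh_max => //.
have -> : (map_mx Num.norm v *m (map_mx Num.norm v)^T) 0 0 = (v *m v^T) 0 0.
  rewrite !mxE; apply: eq_bigr => i _.
  by rewrite !mxE -expr2 real_normK ?num_real.
suff -> : c * (v *m v^T) 0 0 = (v *m A *m v^T) 0 0.
  rewrite !mxE; apply: ler_sum => j _; rewrite !mxE.
  rewrite (le_trans (ler_norm _)) // normrM ler_wpM2r //.
  rewrite (le_trans (ler_norm_sum _ _ _)) //; apply: ler_sum => i _.
  by rewrite normrM !mxE (ger0_norm (A_ge0 _ _)).
by rewrite vA -scalemxAl [RHS]mxE.
Qed.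

(** The j-th coordinate of |v| A = c |v| is a sum of nonnegative terms, among
    them |v_i| A_ij > 0. *)
Lemma top_eigenvector_neq0 (v : 'rV[R]_n) i j :
  v *m A = c *: v -> v 0 i != 0 -> v 0 j != 0.
Proof.
move=> /top_eigenvector_abs vA vi; have [<- //|ij] := eqVneq i j.
have : 0 < (map_mx Num.norm v *m A) 0 j.
  rewrite mxE (bigD1 i) //= ltr_pwDl //.
    by rewrite mxE mulr_gt0 ?normr_gt0 // posA.
  by apply: sumr_ge0 => k _; rewrite mxE mulr_ge0.
by rewrite vA !mxE; apply: contraTneq => ->; rewrite normr0 mulr0 ltxx.
Qed.

(** A c-eigenvector with one zero entry vanishes, by [top_eigenvector_neq0].
    Subtracting from v the multiple of |x| that agrees with it at one entry
    therefore gives 0. *)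
Lemma perron : eigenvalue A c ->
  exists x : 'rV[R]_n, (forall i, 0 < x 0 i) /\
    forall v, v *m A = c *: v -> exists k, v = k *: x.
Proof.
move=> /eigenvalueP[x xA x0]; exists (map_mx Num.norm x).
have [i xi] : exists i, x 0 i != 0 by apply/rV0Pn.
have x_neq0 j := top_eigenvector_neq0 j xA xi.
split=> [j|v vA]; first by rewrite mxE normr_gt0.
exists (v 0 i / `|x 0 i|); apply/eqP; rewrite -subr_eq0; apply/eqP.
set w := v - _.
have wA : w *m A = c *: w.
  rewrite mulmxBl vA -scalemxAl top_eigenvector_abs // scalerBr !scalerA.
  by rewrite [c * _]mulrC.
have wi : w 0 i = 0 by rewrite !mxE divfK ?subrr // normr_eq0.
apply/rowP => j; rewrite [RHS]mxE; apply/eqP; apply: contraT => wj.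
by have := top_eigenvector_neq0 i wA wj; rewrite wi eqxx.
Qed.

End PositiveSymmetric.

(** If a and b are the two smaller eigenvalues and M = (A - a)(A - b), then
    M A = c M, so each row of M is a multiple of the Perron vector x; by
    symmetry so is each column. *)
Lemma three_eigenvalues_rank_one (R : rcfType) n (A : 'M[R]_n) (s : seq R) :
    A^T = A -> (forall i, 0 <= A i i) -> (forall i j, i != j -> 0 < A i j) ->
    uniq s -> size s = 3 -> (forall a, (a \in s) = eigenvalue A a) ->
  exists (sg p k : R) (x : 'I_n -> R), (forall i, 0 < x i) /\
    forall i j, \sum_l A i l * A l j + sg * A i j + p * (i == j)%:R
      = k * x i * x j.
Proof.
move=> symA diagA posA us ss eig_s.
have [a [b [c [eig_abc c_max]]]] : exists a b c,
    (forall t, (t \in [:: a; b; c]) = eigenvalue A t) /\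
    (forall t, eigenvalue A t -> t <= c).
  have := sort_le_sorted s; have := mem_sort <=%O s; have := size_sort <=%O s.
  rewrite ss; case: (sort <=%O s) => [|a [|b [|c []]]] // _ mem_abc.
  move=> /= /and3P[ab bc _]; exists a, b, c.
  have eig_abc t : (t \in [:: a; b; c]) = eigenvalue A t by rewrite mem_abc eig_s.
  split=> // t; rewrite -eig_abc !inE => /or3P[] /eqP-> //.
  exact: le_trans ab bc.
have eig_c : eigenvalue A c by rewrite -eig_abc !inE eqxx !orbT.
have [x [x_gt0 eig_x]] := perron symA diagA posA c_max eig_c.
pose M := (A - a%:M) *m (A - b%:M).
have MA : M *m A = c *: M.
  have : \prod_(t <- [:: a; b; c]) (A - t%:M) = 0.
    by apply: symmetric_annihilator => // t; rewrite eig_abc.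
  rewrite !big_cons big_nil mulr1 mulrA -!mulmxE mulmxBr mul_mx_scalar.
  by move/eqP; rewrite subr_eq0 => /eqP.
have ME i j :
    M i j = \sum_l A i l * A l j - (a + b) * A i j + a * b * (i == j)%:R.
  rewrite /M mulmxBl !mulmxBr !mul_mx_scalar !mul_scalar_mx !mxE.
  by move: (\sum_l _) (A i j) (i == j) => S t []; rewrite /=; ring.
have symM i j : M i j = M j i.
  have AC u v : A u v = A v u by rewrite -{1}symA mxE.
  rewrite !ME eq_sym (AC j i); congr (_ - _ + _).
  by apply: eq_bigr => l _; rewrite (AC i) (AC j) mulrC.
have rowM i : exists t, forall j, M i j = t * x 0 j.
  have [|t rowE] := eig_x (row i M); first by rewrite -row_mul MA linearZ.
  by exists t => j; have /rowP/(_ j) := rowE; rewrite !mxE.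
have /eigenvalueP[y _ /rV0Pn[i0 _]] := eig_c.
have [t rowt] := rowM i0; have x0 := x_gt0 i0.
exists (- (a + b)), (a * b), (t / x 0 i0), (x 0); split=> // i j.
rewrite mulNr -ME; have [r rowr] := rowM i; rewrite rowr.
suff -> : r = t / x 0 i0 * x 0 i by [].
by rewrite mulrAC -rowt symM rowr mulfK ?gt_eqF.
Qed.

(** * From the distance matrix to functions on vertices *)

Section DistanceSpectrum.
Variables (R : realType) (V : finType) (e : rel V).
Hypothesis tree_e : is_tree e.

Local Notation d := (graph_dist e).
Local Notation D x y := ((d x y)%:R : R).

Lemma sum_enum_val (F : V -> R) : \sum_(i < #|V|) F (enum_val i) = \sum_v F v.
Proof. by rewrite -big_enum_val; apply: eq_bigl => v; rewrite inE. Qed.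

Lemma distance_eigenvalueP a :
  distance_eigenvalue e a <->
  exists x : V -> R, (exists v, x v != 0) /\
    forall v, \sum_u x u * D u v = a * x v.
Proof.
split=> [/eigenvalueP[x xA /rV0Pn[i xi]]|[x [[v xv] xA]]].
  exists (fun v => x 0 (enum_rank v)); split=> [|v].
    by exists (enum_val i); rewrite enum_valK.
  have /rowP/(_ (enum_rank v)) := xA; rewrite !mxE => <-.
  rewrite -sum_enum_val; apply: eq_bigr => j _.
  by rewrite !mxE enum_valK enum_rankK.
apply/eigenvalueP; exists (\row_i x (enum_val i)).
  apply/rowP => j; rewrite !mxE -xA -sum_enum_val.
  by apply: eq_bigr => i _; rewrite !mxE.
by apply/rV0Pn; exists (enum_rank v); rewrite mxE enum_rankK.
Qed.

Lemma distinct_eigenvalues_le_card n :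
  num_distinct_distance_eigenvalues R e n -> (n <= #|V|)%N.
Proof.
case=> s [us <- eig_s]; pose p := char_poly (distance_matrix R e).
rewrite -ltnS -(size_char_poly (distance_matrix R e)).
apply: max_poly_roots us; first by rewrite -size_poly_gt0 size_char_poly.
by apply/allP => a; rewrite eig_s -eigenvalue_root_char.
Qed.

Lemma three_distance_eigenvalues_rank_one :
    num_distinct_distance_eigenvalues R e 3 ->
  exists (sg p k : R) (x : V -> R), (forall v, 0 < x v) /\
    forall u v, \sum_l D u l * D l v + sg * D u v + p * (u == v)%:R
      = k * x u * x v.
Proof.
case=> s [us ss eig_s].
have [|i|i j iNj|sg [p [k [x [x_gt0 rk1]]]]] :=
    three_eigenvalues_rank_one (A := distance_matrix R e) _ _ _ us ss eig_s.
- by apply/matrixP => i j; rewrite !mxE (tree_distC tree_e).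
- by rewrite mxE.
- by rewrite mxE ltr0n lt0n tree_dist_eq0 // (inj_eq enum_val_inj).
exists sg, p, k, (fun v => x (enum_rank v)); split=> [//|u v].
have := rk1 (enum_rank u) (enum_rank v); rewrite (inj_eq enum_rank_inj) => <-.
rewrite mxE !enum_rankK; congr (_ + _ + _).
by rewrite -sum_enum_val; apply: eq_bigr => i _; rewrite !mxE !enum_rankK.
Qed.

End DistanceSpectrum.

(** * The rank-one identity forces diameter at most two *)

Section RankOne.
Variables (R : realFieldType) (V : finType) (e : rel V).
Hypothesis tree_e : is_tree e.

Local Notation d := (graph_dist e).
Local Notation D x y := ((d x y)%:R : R).

Variables (sg p k : R) (x : V -> R).
Hypothesis x_gt0 : forall v, 0 < x v.
Hypothesis rank_one : forall i j,
  \sum_l D i l * D l j + sg * D i j + p * (i == j)%:R = k * x i * x j.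

Let t j := \sum_l D l j.

Lemma sum_indicator (F : V -> R) u : \sum_l (l == u)%:R * F l = F u.
Proof.
rewrite (bigD1 u) //= eqxx mul1r big1 ?addr0 // => l /negbTE->.
by rewrite mul0r.
Qed.

(** Subtracting the rows of a and b in the identity replaces D^2 by g D, where
    g is the difference of the two rows of D; this is useful when g has a
    simple form. *)
Lemma row_difference a b (g : V -> R) j :
    (forall l, D a l - D b l = g l) ->
  \sum_l g l * D l j + sg * g j + p * ((a == j)%:R - (b == j)%:R)
    = k * (x a - x b) * x j.
Proof.
move=> gE; have -> : \sum_l g l * D l j =
    \sum_l D a l * D l j - \sum_l D b l * D l j.
  by rewrite -sumrB; apply: eq_bigr => l _; rewrite -gE mulrBl.
transitivity (k * x a * x j - k * x b * x j); last by ring.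
by rewrite -!rank_one -gE; ring.
Qed.

(** For a pendant vertex u with neighbour v, the difference of the rows of D is
    1 - 2 [l = u], so that its product with D reduces to the transmission
    t j (the sum of the distances to j) and a single row of D. *)
Lemma pendant_row u v j :
    e u v -> (forall l, l != u -> d u l = (d v l).+1) ->
  t j - 2 * D u j + sg * (1 - 2 * (j == u)%:R)
    + p * ((u == j)%:R - (v == j)%:R) = k * (x u - x v) * x j.
Proof.
move=> euv pend.
have duu : d u u = 0%N by apply/eqP; rewrite tree_dist_eq0.
have dvu : d v u = 1%N by apply/eqP; rewrite tree_distC -?tree_dist_edge.
rewrite -(row_difference (g := fun l => 1 - 2 * (l == u)%:R)) => [|l].
  congr (_ + _ + _).
  rewrite /t -(sum_indicator (fun l => D l j)) mulr_sumr -sumrB.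
  by apply: eq_bigr => l _; ring.
have [->|/pend->] := eqVneq l u; first by rewrite duu dvu /=; ring.
by rewrite -natr1 /=; ring.
Qed.

Section FarPendants.
Variables u v w z : V.
Hypotheses (euv : e u v) (ewz : e w z).
Hypothesis pend_u : forall l, l != u -> d u l = (d v l).+1.
Hypothesis pend_w : forall l, l != w -> d w l = (d z l).+1.
Hypothesis far : (3 <= d u w)%N.

Let dC := tree_distC tree_e.
Let d0 a : d a a = 0%N. Proof. by apply/eqP; rewrite tree_dist_eq0. Qed.
Let d_neq a b : (0 < d a b)%N -> a != b.
Proof. by rewrite lt0n tree_dist_eq0. Qed.
Let duv : d u v = 1%N. Proof. by apply/eqP; rewrite -tree_dist_edge. Qed.
Let dwz : d w z = 1%N. Proof. by apply/eqP; rewrite -tree_dist_edge. Qed.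
Let uNw : u != w. Proof. by apply: d_neq; lia. Qed.
Let duw : d u w = (d v w).+1. Proof. by apply: pend_u; rewrite eq_sym. Qed.
Let vNw : v != w. Proof. by apply: d_neq; lia. Qed.
Let dvw : d v w = (d v z).+1.
Proof. by rewrite dC (dC v); apply: pend_w. Qed.
Let vNz : v != z. Proof. by apply: d_neq; lia. Qed.
Let uNv : u != v. Proof. by apply: d_neq; lia. Qed.
Let wNz : w != z. Proof. by apply: d_neq; lia. Qed.
Let uNz : u != z. Proof. by apply: contraTneq far => ->; rewrite dC dwz. Qed.

Let neqE := (negbTE uNw, negbTE vNw, negbTE vNz, negbTE uNv, negbTE wNz,
  negbTE uNz).
Let neqE' : (((w == u) = false) * ((w == v) = false) * ((z == v) = false)
  * ((v == u) = false) * ((z == w) = false) * ((z == u) = false))%type.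
Proof. by do !split; rewrite eq_sym !neqE. Qed.

Let row_u j := pendant_row j euv pend_u.
Let row_w j := pendant_row j ewz pend_w.
Let al := k * (x u - x v).

(** The equations of the pairs (u, v) and (w, z) have opposite differences at u
    and w, hence (al - be) (x u + x w) = 0 for their slopes al and be; here the
    positivity of x is essential. *)
Lemma pendant_slopes_eq : k * (x w - x z) = al.
Proof.
have := row_u u; have := row_u w; have := row_w u; have := row_w w.
rewrite !eqxx !neqE !neqE' !d0 (dC w u) -/al /=.
move: (k * (x w - x z)) => be ww wu uw uu.
have : (al - be) * (x u + x w) = 0 by lra.
move/eqP; rewrite mulf_eq0 => /orP[/eqP|/eqP]; first by lra.
by have := x_gt0 u; have := x_gt0 w; lra.
Qed.

Let wE : k * (x w - x z) = al := pendant_slopes_eq.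

(** Equating the two equations at u gives 2 d u w - 2 sg + p = 0, and equating
    them at v gives p = 2 d u w - 4. *)
Lemma coefficients_far_pendants :
  p = 2 * D u w - 4 /\ sg = 2 * D u w - 2.
Proof.
have := row_u u; have := row_w u; have := row_u v; have := row_w v.
rewrite !eqxx !neqE !neqE' !d0 (dC w u) (dC w v) wE -/al /=.
rewrite duv [in D u w]duw -natr1; lra.
Qed.

(** Away from u, v, w, z the two equations reduce to
    t j - 2 d u j + sg = al x j and t j - 2 d w j + sg = al x j. *)
Lemma equidistant_far_pendants j :
  j \notin [:: u; v; w; z] -> d u j = d w j.
Proof.
rewrite !inE !negb_or => /and4P[/negbTE ju /negbTE jv /negbTE jw /negbTE jz].
apply/eqP; rewrite -(eqr_nat R); apply/eqP.
have := row_u j; have := row_w j.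
rewrite wE ju jw !(eq_sym _ j) ju jv jw jz -/al /=; lra.
Qed.

Lemma slope_far_pendants : al * x v = t v /\ al * x u = t u - 2.
Proof.
have [pE sgE] := coefficients_far_pendants.
have := row_u u; have := row_u v.
rewrite !eqxx !neqE' !neqE d0 duv -/al /=; lra.
Qed.

Let t_ge0 (P : pred V) a : 0 <= \sum_(l | P l) D l a.
Proof. by apply: sumr_ge0. Qed.

(** If d u w = 3, then v and z are adjacent, and a further vertex, equidistant
    from u and w, would be equidistant from v and z. So the tree is the path
    u v z w, with transmissions 6 at u and 4 at v, and [slope_far_pendants]
    gives al x u = al x v = 4. Hence x u = x v, although the slope
    al = k (x u - x v) is nonzero. *)
Lemma far_pendants_not3 : d u w != 3.
Proof.
apply/eqP => d3; have dvz : d v z = 1%N by move: duw dvw; rewrite d3 => -[<-] [].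
have all4 j : j \in [:: u; v; w; z].
  apply: contraT => jN; have duj := equidistant_far_pendants jN.
  move: jN; rewrite !inE !negb_or => /and4P[ju _ jw _].
  move: duj; rewrite (pend_u ju) (pend_w jw) => -[dvj].
  have /(tree_edge_dist tree_e j) : e v z by rewrite tree_dist_edge // dvz.
  by rewrite dvj; clear; lia.
have sumE (F : V -> R) : \sum_l F l = F u + F v + F w + F z.
  rewrite (bigD1 u) // (bigD1 v) 1?eq_sym // (bigD1 w) /=; last first.
    by rewrite !(eq_sym w) uNw.
  rewrite (bigD1 z) /=; last by rewrite !(eq_sym z) uNz vNz.
  rewrite big1 ?addr0 ?addrA // => j /andP[/andP[/andP[ju jv] jw] jz].
  by have := all4 j; rewrite !inE (negbTE ju) (negbTE jv) (negbTE jw) (negbTE jz).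
have [xv xu] := slope_far_pendants.
have duz : d u z = 2%N by rewrite pend_u 1?eq_sym ?dvz.
have tu : t u = 6 by rewrite /t sumE d0 !(dC _ u) duv d3 duz; ring.
have tv : t v = 4.
  by rewrite /t sumE d0 duv !(dC _ v) dvz dvw dvz; ring.
have : al * (x u - x v) = 0 by lra.
move/eqP; rewrite mulf_eq0 => /orP[/eqP al0|/eqP xuv].
  by move: xv; rewrite al0 mul0r; lra.
by move: xv; rewrite /al xuv mulr0 mul0r; lra.
Qed.

(** Let m be the second vertex after u on the path to w. It is equidistant from
    u and w, which gives d u w = 4. A further vertex l closer to v than to m
    would, by equidistance, also be closer to z than to m; but m has only one
    neighbour that is closer to l. *)
Lemma far_pendants_middle : exists2 m, e v m &
  d u w = 4%N /\ forall l, l != u -> l != v -> d v l = (d m l).+1.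
Proof.
have d_ne3 := far_pendants_not3.
have [m evm dm] := tree_closer_nbr tree_e vNw; exists m => //.
have dvm : d v m = 1%N by apply/eqP; rewrite -tree_dist_edge.
have mNu : m != u by apply: contra_eq_neq dm => ->; rewrite duw; clear; lia.
have mNv : m != v by apply: contra_eq_neq dm => ->; clear; lia.
have dvz1 : (1 < d v z)%N by move: far d_ne3; rewrite duw dvw; clear; lia.
have mNw : m != w.
  by apply: contra_eq_neq dvm => ->; rewrite dvw; move: dvz1; clear; lia.
have mNz : m != z.
  by apply: contra_eq_neq dvm => ->; move: dvz1; clear; lia.
have dum := pend_u mNu; have dwm := pend_w mNw.
have dmw : d u m = d w m.
  by apply: equidistant_far_pendants; rewrite !inE !negb_or mNu mNv mNw mNz.
rewrite (dC m w) in dm.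
have d4 : d u w = 4%N by move: duw dm dum dwm dmw dvm; clear; lia.
have emz : e m z.
  by rewrite tree_dist_edge // (dC m); move: dwm dmw dum dvm; clear; lia.
split=> // l lNu lNv.
have [->|lNw] := eqVneq l w; first by rewrite (dC m w) dm.
have [->|lNz] := eqVneq l z.
  by move: emz; rewrite tree_dist_edge // => /eqP->; move: d4 duw dvw; clear; lia.
have dul : d u l = d w l.
  by apply/equidistant_far_pendants; rewrite !inE !negb_or lNu lNv lNw lNz.
have := pend_u lNu; have := pend_w lNw => dwl dul'.
have /orP[/eqP//|/eqP dml] := tree_edge_dist tree_e l evm.
have emv : e m v by rewrite tree_dist_edge // dC dvm.
have := tree_closer_nbr_unique tree_e emv emz dml vNz.
by move: dml dul dwl dul'; clear; lia.
Qed.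

(** The rows of v and m in D differ by 1 - 2 [l = u] - 2 [l = v], which gives
    another equation linear in D. Subtracting from it the equation of (u, v)
    gives ga x v = -4 and ga x u = ga x m = -6, where ga = k (x v - x m) - al.
    Hence x u = x m and ga = - 2 al, so t v = al x v = 2, although the
    distances from v to u, m and z already add up to 1 + 1 + 2. *)
Lemma no_far_pendants : False.
Proof.
have [m evm [d4 pend_v]] := far_pendants_middle.
have [pE sgE] := coefficients_far_pendants.
have [xv xu] := slope_far_pendants.
rewrite d4 in pE sgE.
have dvm : d v m = 1%N by apply/eqP; rewrite -tree_dist_edge.
have mNv : m != v by apply: d_neq; rewrite dC dvm.
have mNu : m != u.
  apply/eqP => mu; have := pend_v w; rewrite mu !(eq_sym w) uNw vNw.
  by move=> /(_ isT isT); rewrite duw; clear; lia.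
have dum : d u m = 2%N by rewrite (pend_u mNu) dvm.
have row_v j : t j - 2 * D u j - 2 * D v j
    + sg * (1 - 2 * (j == u)%:R - 2 * (j == v)%:R)
    + p * ((v == j)%:R - (m == j)%:R) = k * (x v - x m) * x j.
  rewrite -(row_difference
      (g := fun l => 1 - 2 * (l == u)%:R - 2 * (l == v)%:R)) => [|l].
    congr (_ + _ + _); rewrite /t -(sum_indicator (fun l => D l j) u).
    rewrite -(sum_indicator (fun l => D l j) v) !mulr_sumr -!sumrB.
    by apply: eq_bigr => l _; ring.
  have [->|lu] := eqVneq l u.
    by rewrite (negbTE uNv) (dC v) (dC m) duv dum /=; ring.
  have [->|lv] := eqVneq l v; first by rewrite d0 (dC m) dvm /=; ring.
  by rewrite pend_v // -natr1 /=; ring.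
have := row_v u; have := row_v v; have := row_v m; have := row_u m.
rewrite !eqxx !neqE' (eq_sym v m) (eq_sym u m) !neqE (negbTE mNv) (negbTE mNu).
rewrite !d0 duv (dC v u) duv dvm dum -/al /=.
set mu := k * (x v - x m) => um vm vv vu.
pose ga := mu - al.
have gv : ga * x v = -4 by rewrite /ga; lra.
have gu : ga * x u = -6 by rewrite /ga; lra.
have gm : ga * x m = -6 by rewrite /ga; lra.
have xum : x u = x m.
  have : ga * (x u - x m) = 0 by lra.
  move/eqP; rewrite mulf_eq0 => /orP[/eqP ga0|/eqP]; last by lra.
  by move: gv; rewrite ga0; lra.
have gaE : ga = - 2 * al by rewrite /ga /mu /al xum; ring.
have tv : t v = 2 by rewrite -xv; move: gv; rewrite gaE; lra.
have zNm : z != m.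
  by apply: contra_eq_neq dvm => <-; move: d4 duw dvw; clear; lia.
move: tv; rewrite /t (bigD1 u) // (bigD1 m) //= (bigD1 z) /=; last first.
  by rewrite eq_sym uNz.
have dvz : d v z = 2%N by move: d4 duw dvw; clear; lia.
rewrite duv (dC m) dvm (dC z) dvz.
have := t_ge0 (fun i => (i != u) && (i != m) && (i != z)) v; lra.
Qed.

End FarPendants.

Lemma rank_one_diameter u w : (forall a b, d a b <= d u w)%N -> (d u w <= 2)%N.
Proof.
move=> diam; rewrite leqNgt; apply/negP => far.
have uNw : u != w by rewrite -(tree_dist_eq0 tree_e) -lt0n; exact: leq_trans far.
have wNu : w != u by rewrite eq_sym.
have [v euv duw] := tree_closer_nbr tree_e uNw.
have [z ewz dwu] := tree_closer_nbr tree_e wNu.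
apply: (no_far_pendants euv ewz _ _ far) => l lN.
  exact: (far_vertex_pendant tree_e (fun a => diam a w) euv duw).
apply: (far_vertex_pendant tree_e _ ewz dwu) => // a.
by rewrite (tree_distC tree_e w u).
Qed.

End RankOne.

(** * Distance spectrum of a star *)

Section Star.

Variables (R : realType) (V : finType) (e : rel V).
Hypothesis tree_e : is_tree e.

Local Notation d := (graph_dist e).
Local Notation D x y := ((d x y)%:R : R).

Variable c : V.
Hypothesis star : forall u v, e u v = ((u == c) != (v == c)).
Let m := #|[pred v | v != c]|.
Hypothesis m_ge2 : (2 <= m)%N.

Lemma star_dist u v :
  d u v = if u == v then 0%N else if (u == c) || (v == c) then 1%N else 2%N.
Proof.
have [->|uNv] := eqVneq u v; first by apply/eqP; rewrite tree_dist_eq0.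
case: ifPn => [uv|/norP[uNc vNc]].
  apply/eqP; rewrite -tree_dist_edge // star.
  case/orP: uv uNv => /eqP->; rewrite eqxx; last by move/negbTE->.
  by rewrite eq_sym => /negbTE->.
have dcv : d c v = 1%N.
  by apply/eqP; rewrite -tree_dist_edge // star eqxx (negbTE vNc).
have /(tree_edge_dist tree_e v) : e u c by rewrite star eqxx (negbTE uNc).
rewrite dcv => /orP[/eqP//|]; rewrite eq_sym eqSS tree_dist_eq0 //.
by rewrite (negbTE uNv).
Qed.

Lemma star_matrix_center (x : V -> R) :
  \sum_u x u * D u c = \sum_(u | u != c) x u.
Proof.
rewrite (bigD1 c) //= star_dist eqxx mulr0 add0r.
by apply: eq_bigr => u /negbTE uc; rewrite star_dist uc eqxx orbT mulr1.
Qed.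

Lemma star_matrix_leaf (x : V -> R) v : v != c ->
  \sum_u x u * D u v = x c + 2 * (\sum_(u | u != c) x u - x v).
Proof.
move=> vNc; rewrite (bigD1 c) //= star_dist eq_sym (negbTE vNc) eqxx mulr1.
congr (_ + _); rewrite [in RHS](bigD1 v) //= [x v + _]addrC addrK.
rewrite (bigD1 v) //= star_dist eqxx mulr0 add0r mulr_sumr.
apply: eq_bigr => u /andP[/negbTE uc /negbTE uv].
by rewrite star_dist uv uc (negbTE vNc) mulrC.
Qed.

(** On an eigenvector x, with S the sum of its entries at the leaves, the
    eigenvalue equation at a leaf v reads (a + 2) x v = x c + 2 S. So for a
    different from -2 all leaves carry the same value xi, and the equations at
    the centre and at a leaf give the quadratic equation. Conversely, a
    difference of two leaves is an eigenvector for -2, and the vector equal to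
    m at the centre and a at the leaves is one for each root a. *)
Lemma star_eigenvalue (a : R) :
  distance_eigenvalue e a <->
  a = -2 \/ a ^+ 2 - 2 * (m%:R - 1) * a - m%:R = 0.
Proof.
have sum_const (y : V -> R) (xi : R) : (forall v, v != c -> y v = xi) ->
    \sum_(u | u != c) y u = m%:R * xi.
  by move=> yE; rewrite (eq_bigr _ yE) sumr_const mulr_natl.
rewrite distance_eigenvalueP; split=> [[x [[v xv] xA]]|].
  have [->|aN2] := eqVneq a (-2); [by left|right].
  have a2 : a + 2 != 0 by rewrite -[2]opprK subr_eq0.
  have := xA c; rewrite star_matrix_center.
  set S := \sum_(u | _) _ => xc.
  pose xi := (x c + 2 * S) / (a + 2).
  have xiE u : u != c -> x u = xi.
    move=> uc; apply: (mulfI a2); rewrite [RHS]mulrC divfK //.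
    by have := xA u; rewrite star_matrix_leaf // -/S; lra.
  have SE : S = m%:R * xi by exact: sum_const.
  have xi2 : (a + 2) * xi = x c + 2 * S by rewrite mulrC divfK.
  have xi0 : xi != 0.
    apply: contraNneq xv => xi0;
    have [->|/xiE->] := eqVneq v c; last by rewrite xi0.
    by apply/eqP; move: xi2; rewrite SE xi0; lra.
  apply: (mulIf xi0); rewrite mul0r.
  have -> : (a ^+ 2 - 2 * (m%:R - 1) * a - m%:R) * xi =
     a * ((a + 2) * xi) - 2 * a * (m%:R * xi) - m%:R * xi by ring.
  by rewrite xi2 -SE mulrDr -xc; ring.
case=> [->|root_a].
  have /card_gt1P[u [v [uc vc uNv]]] := m_ge2.
  rewrite !inE in uc vc; pose x w : R := (w == u)%:R - (w == v)%:R.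
  have S0 : \sum_(w | w != c) x w = 0.
    rewrite (bigD1 u) //= (bigD1 v) /=; last by rewrite vc eq_sym.
    rewrite big1 => [|w /andP[/andP[_ /negbTE wu] /negbTE wv]].
      by rewrite /x !eqxx (eq_sym v u) (negbTE uNv) /=; ring.
    by rewrite /x wu wv subrr.
  have xc : x c = 0 by rewrite /x !(eq_sym c) (negbTE uc) (negbTE vc) subrr.
  exists x; split=> [|w].
    by exists u; rewrite /x eqxx (negbTE uNv) subr0 oner_neq0.
  have [->|wNc] := eqVneq w c; first by rewrite star_matrix_center S0 xc mulr0.
  by rewrite star_matrix_leaf // S0 xc; ring.
have m0 : m%:R != 0 :> R by rewrite pnatr_eq0 -lt0n ltnW.
pose x w := if w == c then m%:R else a.
have SE : \sum_(w | w != c) x w = m%:R * a.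
  by apply: sum_const => w /negbTE; rewrite /x => ->.
exists x; split=> [|w]; first by exists c; rewrite /x eqxx.
have [->|wNc] := eqVneq w c.
  by rewrite star_matrix_center SE /x eqxx mulrC.
rewrite star_matrix_leaf // SE /x eqxx (negbTE wNc).
by apply/eqP; rewrite -subr_eq0 -oppr_eq0 -root_a; apply/eqP; ring.
Qed.

(** The quadratic equation has the roots m - 1 + r and m - 1 - r with
    r^2 = (m - 1)^2 + m, and m - 1 - r > -2 since r < m + 1. *)
Lemma star_three_eigenvalues : num_distinct_distance_eigenvalues R e 3.
Proof.
pose M : R := m%:R; have M2 : 2 <= M by rewrite ler_nat.
pose r := Num.sqrt ((M - 1) ^+ 2 + M).
have r2 : r ^+ 2 = (M - 1) ^+ 2 + M by rewrite sqr_sqrtr //; nra.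
have r_gt0 : 0 < r by rewrite sqrtr_gt0; nra.
exists [:: -2; M - 1 + r; M - 1 - r]; split=> //.
  have rlt : r < M + 1 by rewrite -ltr_sqr ?nnegrE; nra.
  rewrite /= !inE !negb_or !andbT; apply/andP; split; first apply/andP; try split;
    apply/eqP; lra.
move=> a; rewrite !inE; apply/idP/idP => [a_in|/star_eigenvalue].
  apply/star_eigenvalue; rewrite -/M; case/or3P: a_in => /eqP->;
    [by left|right|right].
    by transitivity (r ^+ 2 - (M - 1) ^+ 2 - M); [ring|rewrite r2; ring].
  by transitivity (r ^+ 2 - (M - 1) ^+ 2 - M); [ring|rewrite r2; ring].
rewrite -/M; case=> [->|]; first by rewrite eqxx.
have -> : a ^+ 2 - 2 * (M - 1) * a - M = (a - (M - 1 + r)) * (a - (M - 1 - r)).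
  transitivity ((a - (M - 1)) ^+ 2 - r ^+ 2); [rewrite r2|]; ring.
by move/eqP; rewrite mulf_eq0 !subr_eq0 => /orP[] ->; rewrite ?orbT.
Qed.

End Star.

Lemma star_graph_iso (V : finType) (e : rel V) (c : V) :
  (forall u v, e u v = ((u == c) != (v == c))) ->
  graph_iso e (@complete_bipartite 1 #|[pred v | v != c]|).
Proof.
move=> star; set A := [pred v | v != c].
pose f v : 'I_1 + 'I_#|A| :=
  if insub v : {? v | v \in A} is Some w
  then inr (enum_rank_in (valP w) (val w)) else inl ord0.
pose g (s : 'I_1 + 'I_#|A|) := if s is inr i then enum_val i else c.
exists f; split.
  exists g => [v|[i|i]]; rewrite /f /g.
  - case: insubP => [w _ <-|]; first by rewrite enum_rankK_in ?(valP w).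
    by rewrite inE negbK => /eqP.
  - by rewrite (ord1 i) insubF // inE eqxx.
  - by rewrite insubT ?enum_valP // => vA /=; rewrite enum_valK_in.
move=> u v; rewrite star /f.
by case: insubP => [u' uA _|uA]; case: insubP => [v' vA _|vA];
  move: uA vA; rewrite !inE ?negbK => uA vA;
  rewrite ?(negbTE uA) ?(negbTE vA) ?uA ?vA.
Qed.

Lemma star_of_graph_iso (V : finType) (e : rel V) m :
    graph_iso e (@complete_bipartite 1 m) ->
  exists c, (forall u v, e u v = ((u == c) != (v == c))) /\
    #|[pred v | v != c]| = m.
Proof.
case=> f [[g fK gK] fE]; exists (g (inl ord0)).
have centerE u : (u == g (inl ord0)) = if f u is inl _ then true else false.
  rewrite -(inj_eq (can_inj fK)) gK; case: (f u) => [i|//].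
  by rewrite (ord1 i) eqxx.
split=> [u v|]; first by rewrite -fE !centerE; case: (f u); case: (f v).
have h_inj : injective (fun i : 'I_m => g (inr i)).
  by move=> i j /(can_inj gK) [].
rewrite -[RHS]card_ord -(card_image h_inj).
apply: eq_card => v; rewrite !inE centerE.
apply/idP/imageP => [|[i _ ->]]; last by rewrite gK.
by case E: (f v) => [//|i] _; exists i; rewrite // -E fK.
Qed.

Theorem theorem1p4 (R : realType) (V : finType) (e : rel V)
  (tree_e : is_tree e) :
  num_distinct_distance_eigenvalues R e 3 <->
  exists m : nat, (2 <= m)%N /\ graph_iso e (@complete_bipartite 1 m).
Proof.
split=> [eig3|[m [m_ge2 /star_of_graph_iso [c [star cardE]]]]]; last first.
  by apply: (star_three_eigenvalues R tree_e star); rewrite cardE.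
have V_ge3 := distinct_eigenvalues_le_card eig3.
have [sg [p [k [x [x_gt0 rk1]]]]] :=
  three_distance_eigenvalues_rank_one tree_e eig3.
have [u [w diam]] := tree_diametral_pair tree_e.
have diam_le2 := rank_one_diameter tree_e x_gt0 rk1 diam.
have uNw : u != w.
  apply: contraTneq V_ge3 => uw; rewrite -leqNgt; apply: leqW.
  apply/card_le1_eqP => a b _ _; apply/eqP; rewrite -(tree_dist_eq0 tree_e).
  have /eqP dww : graph_dist e w w == 0%N by rewrite tree_dist_eq0.
  by have := diam b a; rewrite uw dww leqn0.
have [c /(center_edge tree_e) star] := diameter2_center tree_e uNw diam diam_le2.
exists #|[pred v | v != c]|; split; last exact: star_graph_iso.
by move: V_ge3; rewrite (cardD1 c) inE add1n ltnS; congr (_ <= _)%N;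
   apply: eq_card => v; rewrite !inE andbT.
Qed.
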